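(* Let $\psi : [0,\infty) \to [0,\infty)$ be a measurable function such that $0 < 1/c_d := \int_0^\infty u^d \psi(u)\,{\rm d}u < \infty$ for all integers $d \ge 1$. For each $d \ge 1$, let $X_d$ be a random vector in $\mathbb{R}^{d+1}$ with density $x \mapsto c_d\,\psi(\|x\|)$, and let $U_d = \|X_d\|$, which has density $u \mapsto c_d u^d \psi(u)$ on $[0,\infty)$. Define $$u_* = \sup\Big\{u : \int_{u-\varepsilon}^u \psi(v)\,{\rm d}v > 0 \text{ for all } \varepsilon > 0\Big\},$$ and assume $u_* < \infty$. Assume in addition that $\psi$ is bounded and that $\psi(u) \sim a (u_* - u)^b$ as $u \nearrow u_*$, for some constants $a > 0$ and $b > -1$. Then $d\,(u_* - U_d)$ converges in distribution, as $d \to \infty$, to the Gamma distribution with shape parameter $b+1$ and rate $1/u_*$.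
   Context: $f(u) \sim g(u)$ as $u \nearrow u_*$ means $f(u)/g(u) \to 1$. The Gamma distribution with shape $k$ and rate $\lambda$ has density proportional to $x^{k-1}e^{-\lambda x}$ on $(0,\infty)$.
   Formalization: The density c_d ψ(‖x‖) given for X_d in R^{d+1} integrates to the area of the unit sphere, not to 1, so no such X_d exists as written; the theorem is therefore stated for random variables U_d having the density c_d u^d ψ(u) that the statement gives, without the vectors X_d. *)

(* Defs.v *)
From HB Require Import structures.
From mathcomp Require Import all_boot all_order all_algebra.
From mathcomp Require Import all_classical all_reals all_analysis.
Set Implicit Arguments. Unset Strict Implicit. Unset Printing Implicit Defensive.
Import Order.TTheory GRing.Theory Num.Theory.
Import numFieldNormedType.Exports.
Local Open Scope classical_set_scope.
Local Open Scope ring_scope.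

Definition gamma_kernel (R : realType) (k lam : R) (x : R) : R :=
  x `^ (k - 1) * expR (- (lam * x)).

(* Normalized Gamma density: the kernel divided by its total integral
   (i.e. by Gamma(k)/lam^k), and 0 outside (0,oo). *)
Definition gamma_pdf (R : realType) (k lam : R) (x : R) : R :=
  if (0 < x) then
    gamma_kernel k lam x /
      fine (\int[@lebesgue_measure R]_(y in `]0%R, +oo[) (gamma_kernel k lam y)%:E)
  else 0.

Definition cvg_in_distribution_to_density (R : realType) (dT : measure_display)
  (T : measurableType dT) (P : probability T R) (Y : nat -> T -> R) (g : R -> R) :=
  forall f : R -> R, continuous f -> (exists M : R, forall x, `|f x| <= M) ->
    ((fun n => \int[P]_w (f (Y n w))%:E) @ \oo -->
      \int[@lebesgue_measure R]_x (f x * g x)%:E)%E.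

(* The set { u : forall eps > 0, \int_{u-eps}^u psi > 0 } (psi being defined
   on [0,oo), the integral is over [u-eps,u] intersected with [0,oo)). *)
Definition support_pts (R : realType) (psi : R -> R) : set R :=
  [set u : R | forall eps : R, (0 < eps)%R ->
     (0 < \int[@lebesgue_measure R]_(v in `[(u - eps)%R, u] `&` `[0%R, +oo[) (psi v)%:E)%E].

Definition moment (R : realType) (psi : R -> R) (d : nat) : \bar R :=
  \int[@lebesgue_measure R]_(u in `[0%R, +oo[) (u ^+ d * psi u)%:E.

(* Main.v *)
Require Import Defs.
From HB Require Import structures.
From mathcomp Require Import all_boot all_order all_algebra.
From mathcomp Require Import all_classical all_reals all_analysis.
From mathcomp Require Import measurable_realfun ring lra.
Import Order.TTheory GRing.Theory Num.Theory.
Import numFieldNormedType.Exports.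
Local Open Scope classical_set_scope.
Local Open Scope ring_scope.

(* Let s = u_*. Since psi vanishes a.e. above s, substituting u = s - x/d shows
   that d (s - U_d) has a density proportional to
     (1 - x/(s d))^d * d^b psi(s - x/d)   on ]0, s d],
   which converges pointwise to a x^b exp(-x/s). Boundedness of psi forces
   b >= 0, whence psi(u) <= C (s - u)^b on [0, s[, so that these functions are
   dominated by C x^b exp(-x/s). Dominated convergence applies to the integrals
   of f times the density and to the normalizing constants, and the quotient of
   the limits is the integral of f against the Gamma density. *)

(** * Change of variables and change of measure *)

(** The image of Lebesgue measure under y -> s - r y, scaled by r, gives each half-open interval its
    length, so it is Lebesgue measure by uniqueness. *)
Lemma ge0_integral_affine (R : realType) (s r : R) (D : set R)
    (f : R -> \bar R) : 0 < r -> measurable D -> measurable_fun D f ->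
  (forall x, D x -> (0 <= f x)%E) ->
  (\int[@lebesgue_measure R]_(x in D) f x =
   r%:E * \int[@lebesgue_measure R]_(x in (fun y => (s - r * y)%R) @^-1` D)
            f (s - r * x)%R)%E.
Proof.
move=> r0 mD mf f0.
pose phi : measurableTypeR R -> measurableTypeR R := fun y => s - r * y.
have mphi : measurable_fun [set: R] phi.
  by apply: measurable_funB => //; exact: measurable_funM.
have r0' : 0 <= r by exact: ltW.
pose m : {measure set (measurableTypeR R) -> \bar R} := mscale (NngNum r0')
  (measure_function_pushforward__canonical__measure_function_Measure
     (@lebesgue_measure R) mphi).
transitivity (\int[m]_(x in D) f x)%E; last first.
  rewrite ge0_integral_mscale//=; congr (_ * _)%E.
  by rewrite ge0_integral_pushforward// => x; rewrite inE; exact: f0.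
apply: eq_measure_integral => A mA _.
apply: (@lebesgue_measure_unique _ m) => // _ [[a b]] _ <-.
change (lebesgue_measure `]a, b]%classic =
  r%:E * lebesgue_measure (phi @^-1` `]a, b]%classic))%E.
(* The map reverses orientation, so the closed end moves to the left; the preimage has length (b -
   a) / r. *)
rewrite (_ : phi @^-1` _ = `[(s - b) / r, (s - a) / r[%classic); last first.
  apply/seteqP; split => x /=; rewrite !in_itv/= /phi ler_pdivrMr// ltr_pdivlMr//;
    by move=> /andP[? ?]; apply/andP; split; lra.
rewrite !lebesgue_measure_itv/= !lte_fin ltr_pM2r ?invr_gt0//.
have -> : (s - b < s - a) = (a < b) by apply/idP/idP => ?; lra.
case: ifPn => ?; rewrite ?mule0// -!EFinB -EFinM; congr EFin.
by field; rewrite gt_eqF.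
Qed.

(** The Radon-Nikodym derivative of [nu] has the same integral as [g] over every measurable set,
    hence equals [g] almost everywhere. *)
Lemma integral_density d (X : measurableType d) (R : realType)
    (mu : {sigma_finite_measure set X -> \bar R})
    (nu : {finite_measure set X -> \bar R}) (g : X -> R) (f : X -> \bar R) :
  measurable_fun [set: X] g ->
  (forall A, measurable A -> nu A = \int[mu]_(x in A) (g x)%:E)%E ->
  nu.-integrable [set: X] f ->
  (\int[nu]_x f x = \int[mu]_x (f x * (g x)%:E))%E.
Proof.
move=> mg nug intf.
have numu : nu `<< mu.
  apply/null_content_dominatesP => A mA muA0; rewrite nug//.
  apply: null_set_integral => //.
  by apply/measurable_EFinP; exact: measurable_funTS.
rewrite -(Radon_Nikodym_change_of_variables numu)//.
apply: ae_eq_integral => //.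
- by apply: emeasurable_funM => //; exact: (measurable_int nu).
- by apply: emeasurable_funM => //; [exact: (measurable_int nu)|
    exact/measurable_EFinP].
- apply: ae_eqe_mul2l; apply: integral_ae_eq => //.
  + exact: Radon_Nikodym_integrable.
  + exact/measurable_EFinP.
  + by move=> E _ mE; rewrite -Radon_Nikodym_integral// -nug.
Qed.

(** * Vanishing of psi almost everywhere above u_* *)

(* The infimum v0 of the v in [s, u] with ]v, u] `&` N null cannot exceed s:
   otherwise the hypothesis at v0 produces a smaller such v. *)
Lemma left_null_gt (R : realType) (N : set R) (s : R) : measurable N ->
  (forall u, s < u -> exists2 e : R, 0 < e &
     lebesgue_measure (`[u - e, u] `&` N) = 0%E) ->
  lebesgue_measure (`]s, +oo[ `&` N) = 0%E.
Proof.
move=> mN Nnull.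
have mI (i : interval R) : measurable ([set` i] `&` N) by exact: measurableI.
suff Iuc u : s < u -> lebesgue_measure (`]s, u] `&` N) = 0%E.
  (* Bounded intervals suffice, by countable subadditivity. *)
  have sub : `]s, +oo[ `&` N `<=` \bigcup_n (`]s, s + n.+1%:R] `&` N).
    move=> x /= [/[!(in_itv,andbT)]/= sx Nx].
    exists (Num.truncn (x - s)) => //=; split=> //; rewrite in_itv/= sx/=.
    by rewrite -lerBlDl ltW// truncnS_gt.
  have := measure_sigma_subadditive (@lebesgue_measure R)
    (fun n => mI `]s, s + n.+1%:R]) (mI _) sub.
  rewrite eseries0; last by move=> n _ _; apply: Iuc; rewrite ltrDl.
  by move=> le0; apply/eqP; rewrite eq_le le0/=.
move=> su.
pose Z := [set v | s <= v <= u /\ lebesgue_measure (`]v, u] `&` N) = 0%E].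
have Zu : Z u.
  by split; [rewrite lexx ltW|rewrite set_itvoc0// set0I measure0].
have lbZ : lbound Z s by move=> v [/andP[]].
have hZ : has_inf Z by split; [exists u|exists s].
pose v0 := inf Z.
have sv0 : s <= v0 by apply: lb_le_inf => //; exists u.
have v0u : v0 <= u by apply: ge_inf => //; exists s.
(* The infimum is attained: for v in [Z] within e of [v0], the piece []v0, v]] has length at most e
   and the rest is null. *)
have v0null : lebesgue_measure (`]v0, u] `&` N) = 0%E.
  apply/eqP; rewrite eq_le measure_ge0 andbT; apply/lee_addgt0Pr => e e0.
  have [v [/andP[sv vu] vnull] vv0] := inf_adherent e0 hZ.
  rewrite add0e.
  apply: (@le_trans _ _ (lebesgue_measure (`]v0, v] `|` (`]v, u] `&` N)))).
    apply: le_measure; rewrite ?inE; first exact: mI.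
      by apply: measurableU => //; exact: mI.
    move=> x [/=]; rewrite !in_itv/= => /andP[v0x xu] Nx.
    by have [xv|vx] := leP x v; [left; rewrite v0x|right; rewrite xu].
  apply: (le_trans (measureU2 _ _ _)) => //; first exact: mI.
  rewrite [X in (_ + X)%E]vnull adde0.
  move: (lebesgue_measure_itv `]v0, v]) => /= ->; rewrite lte_fin.
  by case: ifPn => _; rewrite ?lee_fin ?(ltW e0)// lerBlDl ltW.
have [<-//|sv0'] := eqVneq v0 s.
have {}sv0' : s < v0 by rewrite lt_neqAle eq_sym sv0'.
have [e e0 enull] := Nnull _ sv0'.
(* The smaller candidate v0 - e is cut off at s so as to stay in [s, u]. *)
have : Z (Num.max s (v0 - e)).
  split; first by rewrite le_max lexx/= ge_max (ltW su)/= lerBlDr ler_wpDr// ltW.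
  have le0 : lebesgue_measure ((`[v0 - e, v0] `&` N) `|` (`]v0, u] `&` N)) = 0%E.
    by rewrite measureU0//; exact: mI.
  apply: subset_measure0 le0; [exact: mI|by apply: measurableU; exact: mI|].
  move=> x [/=]; rewrite !in_itv/= gt_max => /andP[/andP[_ v0x] xu] Nx.
  have [xv|vx] := leP x v0; first by left; rewrite (ltW v0x).
  by right; rewrite xu.
move=> /(ge_inf (ex_intro _ s lbZ)); rewrite -/v0 leNgt gt_max sv0'/=.
by rewrite ltrBlDr ltrDl e0.
Qed.

(** A point u above the supremum is not in [support_pts], so psi has zero integral over some
    [u - e, u]; being nonnegative, it vanishes almost everywhere there, and [left_null_gt] glues
    these intervals. *)
Lemma gt_sup_support_null (R : realType) (psi : R -> R) :
  measurable_fun (`[0, +oo[ : set R) psi -> (forall u, 0 <= u -> 0 <= psi u) ->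
  has_ubound (support_pts psi) ->
  lebesgue_measure (`]sup (support_pts psi), +oo[ `&`
    (`[0, +oo[ `&` psi @^-1` [set~ 0])) = 0%E.
Proof.
move=> mpsi psi0 hub.
have mN : measurable ((`[0, +oo[ : set R) `&` psi @^-1` [set~ 0]).
  by apply: mpsi => //; exact: measurableC.
apply: left_null_gt => // u su.
have : ~ support_pts psi u by move=> /(ub_le_sup hub); rewrite leNgt su.
move=> /existsNP[e /not_implyP[e0 /negP]]; rewrite -leNgt => le0.
exists e => //; set D := (`[(u - e)%R, u] `&` `[0%R, +oo[ : set R).
have mD : measurable D by exact: measurableI.
have mf : measurable_fun D (EFin \o psi).
  by apply/measurable_EFinP; apply: measurable_funS mpsi => //; exact: subIsetr.
have f0 : (\int[lebesgue_measure]_(x in D) `|(EFin \o psi) x| = 0)%E.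
  apply/eqP; rewrite eq_le integral_ge0// andbT; apply: le_trans le0.
  rewrite le_eqVlt; apply/orP; left; apply/eqP; apply: eq_integral => x.
  rewrite inE => -[_ /=]; rewrite in_itv/= andbT => x0.
  by rewrite ger0_norm ?psi0.
have [A [mA A0 sub]] := (@ae_eq_integral_abs _ (measurableTypeR R) R
  lebesgue_measure D mD _ mf).1 f0.
apply: (subset_measure0 _ mA _ A0); first exact: measurableI.
move=> x [xe [x0 /= psix]]; apply: sub => /= /(_ (conj xe x0)) [].
exact: psix.
Qed.

(** * Power bounds on psi to the left of u_* *)

Lemma equiv_powR_bounds (R : realType) (psi : R -> R) (s a b : R) : 0 < a ->
  (fun u => psi u / (a * (s - u) `^ b)) @ s^'- --> (1 : R) ->
  exists2 e : R, 0 < e & forall u, s - e < u -> u < s ->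
    a / 2 * (s - u) `^ b <= psi u <= 2 * a * (s - u) `^ b.
Proof.
move=> a0 /cvgrPdist_lt /(_ (1 / 2)) []; first lra.
move=> e /= e0 He; exists e => // u seu us.
have t0 : 0 < (s - u) `^ b by rewrite powR_gt0// subr_gt0.
have : `|1 - psi u / (a * (s - u) `^ b)| < 1 / 2.
  by apply: He => //=; rewrite ger0_norm ?subr_ge0 ?(ltW us)// ltrBlDr -ltrBlDl.
rewrite ltr_norml => /andP[H1 H2].
have at0 := mulr_gt0 a0 t0.
have H3 : psi u / (a * (s - u) `^ b) < 3 / 2 by lra.
have H4 : 1 / 2 < psi u / (a * (s - u) `^ b) by lra.
move: H3 H4; rewrite ltr_pdivrMr// ltr_pdivlMr// => H3 H4.
by apply/andP; split; lra.
Qed.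

(** For b < 0 the lower bound a / 2 * t^b on psi(s - t) would blow up as t decreases to 0, against
    psi <= M. *)
Lemma bounded_equiv_powR_ge0 (R : realType) (psi : R -> R) (s a b M : R) :
  0 < s -> 0 < a -> (forall u, 0 <= u -> psi u <= M) ->
  (fun u => psi u / (a * (s - u) `^ b)) @ s^'- --> (1 : R) -> 0 <= b.
Proof.
move=> s0 a0 psiM /(equiv_powR_bounds R psi s a b a0)[e e0 He].
rewrite leNgt; apply/negP => b0.
pose N := Num.max M 0 + 1.
have N0 : 0 < N by rewrite ltr_wpDl// le_max lexx orbT.
have MN : M < N by rewrite ltr_pwDr// le_max lexx.
(* [K] solves a / 2 * K^b = N, so t <= K forces psi(s - t) >= N > M. *)
pose K := (a / (2 * N)) `^ (- b)^-1.
have nb0 : 0 < - b by rewrite oppr_gt0.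
have K0 : 0 < K by rewrite powR_gt0// divr_gt0// mulr_gt0.
(* The halves make t < e and t < s strict: the power bounds apply at s - t, and s - t >= 0. *)
pose t := Num.min K (Num.min (e / 2) (s / 2)).
have t0 : 0 < t by rewrite !lt_min K0/= !divr_gt0.
have te : t < e.
  by apply: (@le_lt_trans _ _ (e / 2)); [rewrite !ge_min lexx !orbT|lra].
have ts : t < s.
  by apply: (@le_lt_trans _ _ (s / 2)); [rewrite !ge_min lexx !orbT|lra].
have tK : t <= K by rewrite ge_min lexx.
have /andP[+ _] : a / 2 * (s - (s - t)) `^ b <= psi (s - t) <=
    2 * a * (s - (s - t)) `^ b by apply: He; lra.
have := psiM (s - t); rewrite subr_ge0 (ltW ts) => /(_ isT) psit.
have -> : s - (s - t) = t by lra.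
rewrite -(opprK b) powRN => Hle.
have tb : t `^ (- b) <= a / (2 * N).
  have -> : a / (2 * N) = K `^ (- b).
    by rewrite -powRrM mulVf ?gt_eqF// powRr1// divr_ge0 ?ltW// mulr_gt0.
  by rewrite ge0_ler_powR// ?nnegrE ltW.
have : N <= a / 2 * (t `^ (- b))^-1.
  rewrite ler_pdivlMr ?powR_gt0//.
  apply: (@le_trans _ _ (N * (a / (2 * N)))); first by rewrite ler_pM2l.
  by rewrite le_eqVlt; apply/orP; left; apply/eqP; field; rewrite gt_eqF.
lra.
Qed.

(** Within e of s the equivalence gives the constant 2 a. Farther away (s - u)^b >= e^b because b >=
    0, so |M| / e^b works. *)
Lemma bounded_equiv_powR_le (R : realType) (psi : R -> R) (s a b M : R) :
  0 < a -> 0 <= b -> (forall u, 0 <= u -> psi u <= M) ->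
  (fun u => psi u / (a * (s - u) `^ b)) @ s^'- --> (1 : R) ->
  exists2 C : R, 0 < C &
    forall u, 0 <= u -> u < s -> psi u <= C * (s - u) `^ b.
Proof.
move=> a0 b0 psiM /(equiv_powR_bounds R psi s a b a0)[e e0 He].
have eb0 : 0 < e `^ b by rewrite powR_gt0.
exists (Num.max (2 * a) (`|M| / e `^ b)); first by rewrite lt_max mulr_gt0.
move=> u u0 us.
have [seu|use] := ltP (s - e) u.
  have /andP[_ /le_trans] := He _ seu us; apply.
  by rewrite ler_wpM2r ?powR_ge0// le_max lexx.
apply: (@le_trans _ _ (`|M| / e `^ b * (s - u) `^ b)); last first.
  by rewrite ler_wpM2r ?powR_ge0// le_max lexx orbT.
rewrite mulrAC ler_pdivlMr//; apply: (@le_trans _ _ (`|M| * e `^ b)).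
  by rewrite ler_wpM2r ?powR_ge0// (le_trans (psiM _ u0))// ler_norm.
by rewrite ler_wpM2l// ge0_ler_powR// ?nnegrE; lra.
Qed.

(** * Integrability and positive mass of the Gamma kernel *)

Lemma measurable_gamma_kernel (R : realType) (k lam : R) :
  measurable_fun [set: R] (gamma_kernel k lam).
Proof.
apply: measurable_funM; first exact: measurable_powR.
apply: measurableT_comp => //; apply: measurable_funN.
exact: measurable_funM.
Qed.

Lemma gamma_kernel_ge0 (R : realType) (k lam x : R) : 0 <= gamma_kernel k lam x.
Proof. by rewrite mulr_ge0 ?powR_ge0 ?expR_ge0. Qed.

(* With K = 2 k / lam, x / K <= exp(x / K) gives
   x^(k - 1) <= K^(k - 1) exp(lam x / 2). *)
Lemma gamma_kernel_le_exp (R : realType) (k lam x : R) : 1 <= k -> 0 < lam ->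
  0 < x ->
  gamma_kernel k lam x <= (2 * k / lam) `^ (k - 1) * expR (- (lam / 2 * x)).
Proof.
move=> k1 lam0 x0; rewrite /gamma_kernel; set K := 2 * k / lam.
have k0 : 0 < k by lra.
have K0 : 0 < K by rewrite divr_gt0// mulr_gt0.
have -> : - (lam / 2 * x) = lam / 2 * x + - (lam * x) by lra.
rewrite expRD mulrA ler_pM2r ?expR_gt0//.
have -> : x = K * (x / K) by rewrite mulrC divfK ?gt_eqF.
have xK0 : 0 <= x / K by rewrite ltW// divr_gt0.
rewrite powRM ?(ltW K0)// ler_wpM2l ?powR_ge0//.
apply: (@le_trans _ _ (expR (x / K) `^ (k - 1))).
  rewrite ge0_ler_powR// ?nnegrE ?expR_ge0 ?subr_ge0//.
  by rewrite (le_trans _ (expR_ge1Dx _))// lerDr.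
rewrite -expRM ler_expR.
have -> : lam / 2 * (K * (x / K)) = x / K * k.
  by rewrite /K; field; rewrite !gt_eqF.
by rewrite ler_wpM2l// gerBl.
Qed.

Lemma integrable_gamma_kernel (R : realType) (k lam : R) : 1 <= k -> 0 < lam ->
  (@lebesgue_measure R).-integrable [set: R]
    (EFin \o (gamma_kernel k lam \_ `]0, +oo[)).
Proof.
move=> k1 lam0.
(* The dominating function is a multiple of the exponential density of rate lam / 2; dividing by lam
   / 2 cancels the normalization of that density. *)
pose C := (2 * k / lam) `^ (k - 1) / (lam / 2).
have C0 : 0 <= C by rewrite divr_ge0 ?powR_ge0// ltW// divr_gt0.
apply: (@le_integrable _ (measurableTypeR R) R lebesgue_measure _ measurableT _
  (fun x => C%:E * (exponential_pdf (lam / 2) x)%:E)%E).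
- apply/measurable_EFinP; apply/measurable_restrict => //.
  by apply: measurable_funTS; exact: measurable_gamma_kernel.
- move=> x _ /=; rewrite lee_fin.
  have pdf0 : 0 <= exponential_pdf (lam / 2) x.
    by apply: exponential_pdf_ge0; rewrite ltW// divr_gt0.
  rewrite [leRHS]ger0_norm ?(mulr_ge0 C0)// patchE; case: ifPn; last first.
    by rewrite normr0 (mulr_ge0 C0).
  rewrite inE/= in_itv/= andbT => x0.
  rewrite ger0_norm ?gamma_kernel_ge0//.
  rewrite (le_trans (gamma_kernel_le_exp _ _ _ _ k1 lam0 x0))//.
  rewrite exponential_pdfE ?(ltW x0)// /C mulrA divfK ?mulNr//.
  by rewrite gt_eqF// divr_gt0.
- apply: integrableZl => //; apply: integrable_exponential_pdf.
  by rewrite divr_gt0.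
Qed.

(** On ]1, 2] the kernel is at least exp(-2 lam), since x^(k - 1) >= 1 there. *)
Lemma integral_gamma_kernel_gt0 (R : realType) (k lam : R) : 1 <= k -> 0 < lam ->
  (0 < \int[@lebesgue_measure R]_(x in `]0%R, +oo[) (gamma_kernel k lam x)%:E)%E.
Proof.
move=> k1 lam0.
apply: (@lt_le_trans _ _
    (\int[lebesgue_measure]_(x in `]1%R, 2%R]) (expR (- (lam * 2)))%:E)%E).
  rewrite integral_cst//=; move: (lebesgue_measure_itv `]1%R, 2%R] :
    lebesgue_measure (`]1%R, 2%R] : set R) = _) => /= ->.
  rewrite lte_fin ltr1n/=.
  by rewrite -EFinB -EFinM lte_fin mulr_gt0 ?expR_gt0//; lra.
apply: (@le_trans _ _
    (\int[lebesgue_measure]_(x in `]1%R, 2%R]) (gamma_kernel k lam x)%:E)%E).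
  apply: ge0_le_integral => //.
  - by apply/measurable_EFinP; apply: measurable_funTS; exact: measurable_gamma_kernel.
  - move=> x /=; rewrite in_itv/= => /andP[x1 x2].
    have xk : 1 <= x `^ (k - 1).
      by rewrite -[leLHS](powRr0 x); apply: ler_powR; [exact: ltW|lra].
    rewrite lee_fin -[leLHS]mul1r; apply: ler_pM; rewrite ?expR_ge0//.
    by rewrite ler_expR lerN2 ler_wpM2l// ltW.
apply: ge0_subset_integral => //.
- by apply/measurable_EFinP; apply: measurable_funTS; exact: measurable_gamma_kernel.
- by move=> x _; rewrite lee_fin gamma_kernel_ge0.
- by move=> x /=; rewrite !in_itv/= => /andP[x1 _]; rewrite andbT; lra.
Qed.

(** * The exponential limit, with two-sided bounds *)

(** This is 1 + z <= exp z at z = - t / n.+1, raised to a power; the bound on t keeps the base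
    nonnegative. *)
Lemma expr1B_le_expR (R : realType) (t : R) (n : nat) : t <= n.+1%:R ->
  (1 - t / n.+1%:R) ^+ n.+1 <= expR (- t).
Proof.
move=> tn; have n0 : 0 < n.+1%:R :> R by [].
have -> : - t = - (t / n.+1%:R) * n.+1%:R by rewrite mulNr divfK ?gt_eqF.
rewrite expRM_natr lerXn2r ?nnegrE ?expR_ge0 ?subr_ge0 ?ler_pdivrMr ?mul1r//.
exact: expR_ge1Dx.
Qed.

(** With y = t / n.+1 and z = y / (1 - y), one has 1 / (1 - y) = 1 + z <= exp z; invert and raise to
    the power n.+1. *)
Lemma expr1B_ge_expR (R : realType) (t : R) (n : nat) : t < n.+1%:R ->
  expR (- (t / (1 - t / n.+1%:R))) <= (1 - t / n.+1%:R) ^+ n.+1.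
Proof.
move=> tn; have n0 : 0 < n.+1%:R :> R by [].
set y := t / n.+1%:R.
have y1 : 0 < 1 - y by rewrite subr_gt0 ltr_pdivrMr ?mul1r.
have -> : - (t / (1 - y)) = - (y / (1 - y)) * n.+1%:R.
  by rewrite mulNr mulrAC divfK ?gt_eqF.
rewrite expRM_natr lerXn2r ?nnegrE ?expR_ge0 ?(ltW y1)//.
rewrite expRN -[leRHS]invrK lef_pV2 ?posrE ?expR_gt0 ?invr_gt0//.
apply: le_trans (expR_ge1Dx _).
by rewrite le_eqVlt; apply/orP; left; apply/eqP; field; rewrite gt_eqF.
Qed.

Lemma cvg_expr1B (R : realType) (t : R) :
  (1 - t / n.+1%:R) ^+ n.+1 @[n --> \oo] --> expR (- t).
Proof.
have t1 : (1 - t / n.+1%:R : R) @[n --> \oo] --> (1 : R).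
  rewrite -[X in _ --> X](subr0 1) -(mulr0 t).
  apply: cvgB; first exact: cvg_cst.
  by apply: cvgM; [exact: cvg_cst|exact: cvg_harmonic].
apply: (@squeeze_cvgr _ _ _ _ (fun n => expR (- (t / (1 - t / n.+1%:R))))
   (fun=> expR (- t))).
- near=> n; have tn : t < n.+1%:R.
    apply: (@lt_trans _ _ n%:R); last by rewrite ltr_nat.
    by near: n; exact: nbhs_infty_gtr.
  by rewrite expr1B_le_expR ?(ltW tn)// expr1B_ge_expR.
- apply: (@continuous_cvg _ _ _ _ _ _ (@expR R)); first exact: continuous_expR.
  apply: cvgN; rewrite -[X in _ --> X]divr1.
  by apply: cvgM; [exact: cvg_cst|exact: cvgV].
- exact: cvg_cst.
Unshelve. all: by end_near. Qed.

(** * The rescaled density: domination and pointwise limit *)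

(* The density of d (s - U_d) for d = n.+1, up to a multiplicative constant. *)
Definition scaled_density (R : realType) (psi : R -> R) (s b : R) (n : nat) :
    R -> R :=
  (fun x => (1 - x / s / n.+1%:R) ^+ n.+1 *
     (n.+1%:R `^ b * psi (s - n.+1%:R^-1 * x))) \_ `]0, s * n.+1%:R].

Lemma measurable_scaled_density (R : realType) (psi : R -> R) (s b : R) n :
  measurable_fun (`[0, +oo[ : set R) psi ->
  measurable_fun [set: R] (scaled_density R psi s b n).
Proof.
move=> mpsi; apply/measurable_restrict => //.
apply: measurable_funM.
  apply: measurable_funX; apply: measurable_funB => //.
  by apply: measurable_funM => //; exact: measurable_funM.
apply: measurable_funM => //.
apply: (measurable_comp _ _ mpsi) => //; last first.
  by apply: measurable_funB => //; exact: measurable_funM.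
move=> _ [x + <-]; rewrite /= !in_itv/= andbT subr_ge0 => -[_ /andP[_ xs]].
by rewrite mulrC ler_pdivrMr.
Qed.

Lemma scaled_density_ge0 (R : realType) (psi : R -> R) (s b : R) n x : 0 < s ->
  (forall u, 0 <= u -> 0 <= psi u) -> 0 <= scaled_density R psi s b n x.
Proof.
move=> s0 psi0; rewrite /scaled_density patchE; case: ifPn => //.
rewrite inE/= in_itv/= => /andP[x0 xs].
rewrite !mulr_ge0 ?powR_ge0//.
  rewrite exprn_ge0// subr_ge0 !ler_pdivrMr// mul1r mulrC//.
by rewrite psi0// subr_ge0 mulrC ler_pdivrMr.
Qed.

(** The bound C (x / n.+1)^b on psi absorbs the factor n.+1^b and leaves C x^b, while
    [expr1B_le_expR] at t = x / s bounds the remaining power by exp(-x / s). *)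
Lemma scaled_density_le (R : realType) (psi : R -> R) (s b C : R) n x :
  0 < s -> 0 <= C ->
  (forall u, 0 <= u -> 0 <= psi u) ->
  (forall u, 0 <= u -> u < s -> psi u <= C * (s - u) `^ b) ->
  scaled_density R psi s b n x <=
    C * (gamma_kernel (b + 1) s^-1 \_ `]0, +oo[) x.
Proof.
move=> s0 C0 psi0 psiC; rewrite /scaled_density !patchE; case: ifPn; last first.
  by case: ifPn => _ _; rewrite mulr_ge0// gamma_kernel_ge0.
rewrite inE/= in_itv/= => /andP[x0 xs].
rewrite mem_set/= ?in_itv/= ?x0//.
have n0 : 0 < n.+1%:R :> R by [].
have u0 : 0 <= s - n.+1%:R^-1 * x by rewrite subr_ge0 mulrC ler_pdivrMr.
have us : s - n.+1%:R^-1 * x < s by rewrite gtrBl mulr_gt0 ?invr_gt0.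
rewrite /gamma_kernel addrK mulrA mulrC.
apply: ler_pM; rewrite ?mulr_ge0 ?powR_ge0 ?psi0//.
- by rewrite exprn_ge0// subr_ge0 !ler_pdivrMr// mul1r mulrC.
- apply: (@le_trans _ _ (n.+1%:R `^ b * (C * (n.+1%:R^-1 * x) `^ b))).
    rewrite ler_wpM2l ?powR_ge0// (le_trans (psiC _ u0 us))//.
    by rewrite opprB addrC subrK.
  have y0 : 0 <= n.+1%:R^-1 * x by rewrite ltW// mulr_gt0 ?invr_gt0.
  rewrite mulrCA ler_wpM2l// -powRM ?(ltW n0)//.
  by rewrite mulVKf ?gt_eqF.
- by rewrite (mulrC s^-1) expr1B_le_expR// ler_pdivrMr// mulrC.
Qed.

(** For x > 0, n.+1^b psi(s - x / n.+1) is a x^b times the ratio in the equivalence, evaluated along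
    a sequence tending to s from the left. For x <= 0 every term is 0. *)
Lemma cvg_scaled_density (R : realType) (psi : R -> R) (s a b x : R) :
  0 < s -> 0 < a ->
  (fun u => psi u / (a * (s - u) `^ b)) @ s^'- --> (1 : R) ->
  scaled_density R psi s b n x @[n --> \oo] -->
    a * (gamma_kernel (b + 1) s^-1 \_ `]0, +oo[) x.
Proof.
move=> s0 a0 psi_equiv; rewrite patchE; case: ifPn => [|xn]; last first.
  rewrite mulr0 [X in X @ \oo --> _](_ : _ = fun=> 0); first exact: cvg_cst.
  apply/funext => n; rewrite /scaled_density patchE ifF//.
  apply: contraNF xn; rewrite !inE/= !in_itv/= andbT.
  by move=> /andP[].
rewrite inE/= in_itv/= andbT => x0.
have := (cvg_at_leftP _ _ _).1 psi_equiv (fun n => s - n.+1%:R^-1 * x).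
have us : (forall n, s - n.+1%:R^-1 * x < s) /\
    s - n.+1%:R^-1 * x @[n --> \oo] --> s.
  split=> [n|]; first by rewrite gtrBl mulr_gt0 ?invr_gt0.
  rewrite -[X in _ --> X](subr0 s) -(mul0r x).
  apply: cvgB; first exact: cvg_cst.
  by apply: cvgM; [exact: cvg_harmonic|exact: cvg_cst].
move=> /(_ us) ratio.
have -> : a * gamma_kernel (b + 1) s^-1 x =
    expR (- (x / s)) * (1 * (a * x `^ b)).
  by rewrite /gamma_kernel addrK (mulrC s^-1); ring.
apply: cvg_trans (cvgM (cvg_expr1B R (x / s))
  (cvgM ratio (cvg_cst (a * x `^ b)))).
(* The factorization holds only for large n, once x <= s * n.+1 puts x in the support of the
   density. *)
apply: near_eq_cvg; near=> n.
have n0 : 0 < n.+1%:R :> R by [].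
have xs : x <= s * n.+1%:R.
  rewrite mulrC -ler_pdivrMr//; apply: (@le_trans _ _ n%:R); last by rewrite ler_nat.
  by apply: ltW; near: n; exact: nbhs_infty_gtr.
rewrite /scaled_density patchE mem_set/= ?in_itv/= ?x0//.
congr (_ * _).
have -> : s - (s - n.+1%:R^-1 * x) = n.+1%:R^-1 * x by rewrite opprB addrC subrK.
have -> : x `^ b = n.+1%:R `^ b * (n.+1%:R^-1 * x) `^ b.
  rewrite -powRM ?(ltW n0) ?mulVKf ?gt_eqF//.
  by rewrite ltW// mulr_gt0 ?invr_gt0.
have y0 : 0 < (n.+1%:R^-1 * x) `^ b by rewrite powR_gt0// mulr_gt0// invr_gt0.
set y := (_ * x) `^ b; set p := psi _; set N := _ `^ b.
rewrite -/y in y0; field; rewrite ?gt_eqF//.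
Unshelve. all: by end_near. Qed.

(** * The law of d (u_* - U_d) *)

Lemma integral_lt_sup_support (R : realType) (psi w : R -> R) (B : set R) :
  measurable_fun (`[0, +oo[ : set R) psi -> (forall u, 0 <= u -> 0 <= psi u) ->
  has_ubound (support_pts psi) ->
  measurable_fun [set: R] w -> (forall u, 0 <= u -> 0 <= w u) ->
  measurable B ->
  (\int[@lebesgue_measure R]_(u in B `&` `[0%R, +oo[) (w u * psi u)%:E =
   \int[@lebesgue_measure R]_(u in B `&` `[0%R, sup (support_pts psi)[)
     (w u * psi u)%:E)%E.
Proof.
move=> mpsi psi0 hub mw w0 mB; set s := sup _.
pose D : set R := B `&` `[0%R, +oo[.
have mD : measurable D by exact: measurableI.
have mh : measurable_fun D (fun u => (w u * psi u)%:E).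
  apply/measurable_EFinP; apply: measurable_funM; first exact: measurable_funTS.
  by apply: measurable_funS mpsi => //; exact: subIsetr.
have h0 u : D u -> (0 <= (w u * psi u)%:E)%E.
  by move=> [_ /=]; rewrite in_itv/= andbT => ?; rewrite lee_fin mulr_ge0 ?w0 ?psi0.
have -> : B `&` `[0, s[ = D `&` `[0, s[.
  apply/seteqP; split => [u [Bu us]|u [[Bu _] us]] //; split=> //; split=> //.
  by move: us; rewrite /= !in_itv/= andbT => /andP[].
rewrite [RHS]integral_mkcondr.
apply: ge0_ae_eq_integral => //.
- apply: (iffLR (@measurable_restrict _ _ (measurableTypeR R) _
    `[0, s[%classic D _ _ mD)) => //.
  by apply: measurable_funS mh => //; exact: subIsetl.
- by move=> u Du; rewrite patchE; case: ifPn => // _; exact: h0.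
(* The exceptional null set: the point s, and the points above s where psi is nonzero. *)
exists ([set s] `|` (`]s, +oo[ `&` (`[0, +oo[ `&` psi @^-1` [set~ 0]))); split.
- apply: measurableU => //; apply: measurableI => //.
  by apply: mpsi => //; exact: measurableC.
- rewrite measureU0//; first exact: lebesgue_measure_set1.
  + by apply: measurableI => //; apply: mpsi => //; exact: measurableC.
  + exact: gt_sup_support_null.
- move=> u /= /not_implyP[[Bu u0] neq].
  have [us|su|<-] := ltgtP u s; last by left.
    exfalso; apply: neq; rewrite patchE mem_set//= in_itv/= us andbT.
    by move: u0; rewrite /= in_itv/= andbT.
  right; split; first by rewrite /= in_itv/= su.
  split=> //= psiu; apply: neq; rewrite patchE; case: ifPn => // _.
  by rewrite psiu mulr0.
Qed.

(** If the supremum were <= 0, the first moment would be an integral over an empty interval. This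
    also excludes the default value 0 of [sup] on the empty set. *)
Lemma sup_support_gt0 (R : realType) (psi : R -> R) :
  measurable_fun (`[0, +oo[ : set R) psi -> (forall u, 0 <= u -> 0 <= psi u) ->
  has_ubound (support_pts psi) -> (0 < moment psi 1)%E ->
  0 < sup (support_pts psi).
Proof.
move=> mpsi psi0 hub; apply: contraTT; rewrite -leNgt => s0.
rewrite -leNgt /moment -[X in integral _ X _]setTI.
rewrite (integral_lt_sup_support R psi (fun u => u ^+ 1))//.
by rewrite set_itv_ge ?setI0 ?integral_set0// bnd_simp -leNgt.
Qed.

(** Substitute u = s - x / n.+1 = s (1 - x / (s n.+1)): the power of u yields s^n.+1, the Jacobian
    is 1 / n.+1, and n.+1^b compensates the factor built into [scaled_density]. In the application c
    is the inverse moment. *)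
Lemma scaled_density_law (R : realType) (psi : R -> R) (b c : R) (n : nat)
    (A : set R) (s := sup (support_pts psi)) :
  measurable_fun (`[0, +oo[ : set R) psi -> (forall u, 0 <= u -> 0 <= psi u) ->
  has_ubound (support_pts psi) -> 0 < s -> 0 <= c -> measurable A ->
  (\int[@lebesgue_measure R]_(u in
       (fun u => (n.+1%:R * (s - u))%R) @^-1` A `&` `[0%R, +oo[)
     (c * (u ^+ n.+1 * psi u))%:E =
   (n.+1%:R^-1 * (c * s ^+ n.+1 / n.+1%:R `^ b))%:E *
   \int[@lebesgue_measure R]_(x in A) (scaled_density R psi s b n x)%:E)%E.
Proof.
move=> mpsi psi0 hub s0 c0 mA.
have n0 : 0 < n.+1%:R :> R by [].
set B := _ @^-1` A.
have mB : measurable B.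
  rewrite -[B]setTI.
  have : measurable_fun [set: R] (fun u : R => n.+1%:R * (s - u)).
    by apply: measurable_funM => //; exact: measurable_funB.
  exact.
under eq_integral do rewrite mulrA.
rewrite (integral_lt_sup_support R psi (fun u => c * u ^+ n.+1))//; last 2 first.
- by apply: measurable_funM => //; exact: measurable_funX.
- by move=> u u0; rewrite mulr_ge0// exprn_ge0.
rewrite -/s (ge0_integral_affine R s n.+1%:R^-1) ?invr_gt0//; last 3 first.
- exact: measurableI.
- apply/measurable_EFinP; apply: measurable_funM.
    by apply: measurable_funTS; apply: measurable_funM => //; exact: measurable_funX.
  apply: measurable_funS mpsi => //.
  by move=> u [_ /=]; rewrite !in_itv/= andbT => /andP[].
- move=> u [_ /=]; rewrite !in_itv/= => /andP[u0 _].
  by rewrite lee_fin mulr_ge0 ?psi0// mulr_ge0 ?exprn_ge0.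
(* The substitution inverts the map defining [B], and turns [0, s[ into ]0, s n.+1]. *)
have -> : (fun y => s - n.+1%:R^-1 * y) @^-1` (B `&` `[0, s[) =
    A `&` `]0, s * n.+1%:R].
  apply/seteqP; split => x /=.
    rewrite !in_itv/= => -[Bx].
    rewrite subr_ge0 gtrBl pmulr_rgt0 ?invr_gt0// ler_pdivrMl// mulrC.
    move=> /andP[-> ->]; split=> //.
    by move: Bx; rewrite /B/= opprB addrC subrK mulVKf ?gt_eqF.
  rewrite !in_itv/= => -[Ax /andP[x0 xs]]; split.
    by rewrite /B/= opprB addrC subrK mulVKf ?gt_eqF.
  by rewrite subr_ge0 gtrBl pmulr_rgt0 ?invr_gt0// ler_pdivrMl// mulrC x0 xs.
rewrite EFinM -muleA; congr (_ * _)%E.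
rewrite integral_mkcondr -ge0_integralZl//; last 3 first.
- by apply/measurable_EFinP; apply: measurable_funTS; exact: measurable_scaled_density.
- by move=> x _; rewrite lee_fin scaled_density_ge0.
- by rewrite lee_fin divr_ge0 ?powR_ge0// mulr_ge0// exprn_ge0// ltW.
apply: eq_integral => x _; rewrite /scaled_density !patchE.
case: ifPn => _; rewrite ?mule0// -EFinM; congr EFin.
have -> : s - n.+1%:R^-1 * x = s * (1 - x / s / n.+1%:R).
  by field; rewrite !gt_eqF.
have nb0 : n.+1%:R `^ b != 0 by rewrite gt_eqF// powR_gt0.
by rewrite exprMn; field.
Qed.

(** * Expectations as quotients of integrals, and their limits *)

(** Taking A to be the whole line shows that K is the inverse of the total mass of [k]. The
    normalization, moments included, is thereby traded for a quotient of two integrals. *)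
Lemma integral_normalized_density (R : realType) (dT : measure_display)
    (T : measurableType dT) (P : probability T R) (Y : T -> R) (K : R)
    (k f : R -> R) :
  measurable_fun [set: T] Y ->
  (@lebesgue_measure R).-integrable [set: R] (EFin \o k) ->
  (forall A : set R, measurable A ->
     P (Y @^-1` A) = K%:E * \int[@lebesgue_measure R]_(x in A) (k x)%:E)%E ->
  measurable_fun [set: R] f -> (exists M : R, forall x, `|f x| <= M) ->
  (\int[P]_w (f (Y w))%:E =
   (fine (\int[@lebesgue_measure R]_x (f x * k x)%:E) /
    fine (\int[@lebesgue_measure R]_x (k x)%:E))%:E)%E.
Proof.
move=> mY ik PY mf [M fM].
have mk : measurable_fun [set: R] k.
  by apply/measurable_EFinP; exact: (measurable_int _ ik).
pose Ik := (\int[@lebesgue_measure R]_x (k x)%:E)%E.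
have fin_k : Ik \is a fin_num.
  exact: integrable_fin_num.
have bf : [bounded f x | x in [set: R]].
  by exists M; split; [exact: num_real|
    move=> y My x _ /=; rewrite (le_trans (fM x)) ?ltW].
have ifk : (@lebesgue_measure R).-integrable [set: R] (fun x => (f x * k x)%:E).
  exact: (@integrableMr _ (measurableTypeR R) R lebesgue_measure _ measurableT
    f (EFin \o k) mf bf ik).
have Y1 : K * fine Ik = 1.
  apply: EFin_inj; rewrite EFinM fineK// -PY//.
  by rewrite preimage_setT probability_setT.
have mY' : @measurable_fun _ _ T (measurableTypeR R) [set: T] Y by [].
pose Y' : {RV P >-> measurableTypeR R} := HB.pack Y
  (isMeasurableFun.Build _ _ T (measurableTypeR R) Y mY').
transitivity (\int[distribution P Y']_x (f x)%:E)%E.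
  rewrite integral_distribution//; first exact/measurable_EFinP.
  apply: (@measurable_bounded_integrable _ T R P (f \o Y)) => //.
  - by rewrite -ge0_fin_numE// fin_num_measure.
  - exact: measurableT_comp.
  - by exists M; split; [exact: num_real|
    move=> y My x _ /=; rewrite (le_trans (fM _)) ?ltW].
rewrite (@integral_density _ (measurableTypeR R) R lebesgue_measure
  (distribution P Y') (fun x => K * k x))//.
- under eq_integral do rewrite -EFinM mulrCA EFinM.
  rewrite integralZl// -(fineK (integrable_fin_num _ ifk))// -EFinM; congr EFin.
  rewrite mulrC; congr (_ * _).
  apply: (mulIf (_ : fine Ik != 0)); rewrite -/Ik.
    by apply: contra_eq_neq Y1 => ->; rewrite mulr0 eq_sym oner_neq0.
  rewrite Y1 mulVf//.
  by apply: contra_eq_neq Y1 => ->; rewrite mulr0 eq_sym oner_neq0.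
- exact: measurable_funM.
- move=> A mA; transitivity (P (Y @^-1` A)); first by [].
  rewrite PY// -integralZl//.
  exact: integrableS ik.
- apply: (@measurable_bounded_integrable _ (measurableTypeR R) R (distribution P Y') f) => //.
  - by rewrite -ge0_fin_numE// fin_num_measure.
Qed.

(** Dominated convergence with dominating function M C times the Gamma kernel, where M bounds |f|.
    It serves both the test function and the constant 1, which gives the normalizing integral. *)
Lemma cvg_integral_scaled_density (R : realType) (psi f : R -> R) (s a b C : R) :
  measurable_fun (`[0, +oo[ : set R) psi -> (forall u, 0 <= u -> 0 <= psi u) ->
  0 < s -> 0 < a -> 0 <= b -> 0 <= C ->
  (forall u, 0 <= u -> u < s -> psi u <= C * (s - u) `^ b) ->
  (fun u => psi u / (a * (s - u) `^ b)) @ s^'- --> (1 : R) ->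
  measurable_fun [set: R] f -> (exists M : R, forall x, `|f x| <= M) ->
  (\int[@lebesgue_measure R]_x (f x * scaled_density R psi s b n x)%:E
     @[n --> \oo] -->
   \int[@lebesgue_measure R]_x
     (f x * (a * (gamma_kernel (b + 1) s^-1 \_ `]0%R, +oo[) x))%:E)%E.
Proof.
move=> mpsi psi0 s0 a0 b0 C0 psiC psi_equiv mf [M fM].
have b1 : 1 <= b + 1 by rewrite lerDr.
have s1 : 0 < s^-1 by rewrite invr_gt0.
have M0 : 0 <= M by exact: le_trans (normr_ge0 _) (fM 0).
pose g0 := gamma_kernel (b + 1) s^-1 \_ `]0, +oo[.
have mg0 : measurable_fun [set: R] g0.
  apply/measurable_restrict => //.
  by apply: measurable_funTS; exact: measurable_gamma_kernel.
have [] := @dominated_convergence _ (measurableTypeR R) R lebesgue_measure _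
  measurableT (fun n x => (f x * scaled_density R psi s b n x)%:E)
  (fun x => (f x * (a * g0 x))%:E) (fun x => (M * C)%:E * (g0 x)%:E)%E => //.
- move=> n; apply/measurable_EFinP; apply: measurable_funM => //.
  exact: measurable_scaled_density.
- by apply/measurable_EFinP; apply: measurable_funM => //; exact: measurable_funM.
- apply: aeW => x _; apply: cvg_EFin; first exact: nearW.
  apply: cvgM; first exact: cvg_cst.
  exact: cvg_scaled_density.
- by apply: integrableZl => //; exact: integrable_gamma_kernel.
- apply: aeW => x n _; rewrite -EFinM /= lee_fin normrM -mulrA.
  apply: ler_pM => //.
  by rewrite ger0_norm ?scaled_density_ge0// scaled_density_le// ltW.
Qed.

Theorem theorem2 (R : realType) (psi : R -> R) (a b : R)
  (dT : measure_display) (T : measurableType dT) (P : probability T R)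
  (U : nat -> T -> R) :
  measurable_fun (`[0%R, +oo[ : set R) psi ->
  (forall u, 0 <= u -> 0 <= psi u) ->
  (forall d : nat, (1 <= d)%N -> (0 < moment psi d)%E /\ (moment psi d < +oo)%E) ->
  (* random variable U_d with density c_d u^d psi(u) on [0,oo) *)
  (forall d : nat, (1 <= d)%N -> measurable_fun setT (U d)) ->
  (forall d : nat, (1 <= d)%N -> forall A : set R, measurable A ->
     (P (U d @^-1` A) =
     \int[@lebesgue_measure R]_(u in A `&` `[0%R, +oo[)
        ((fine (moment psi d))^-1 * (u ^+ d * psi u))%:E)%E) ->
  (* u_* < oo *)
  has_ubound (support_pts psi) ->
  (* psi bounded *)
  (exists M : R, forall u, 0 <= u -> psi u <= M) ->
  0 < a -> -1 < b ->
  (* psi(u) ~ a (u_* - u)^b as u increases to u_* *)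
  (fun u => psi u / (a * (sup (support_pts psi) - u) `^ b))
     @ ((sup (support_pts psi))^'-) --> (1 : R) ->
  cvg_in_distribution_to_density P
    (fun d w => d%:R * (sup (support_pts psi) - U d w))
    (gamma_pdf (b + 1) ((sup (support_pts psi))^-1)).
Proof.
move=> mpsi psi0 mom mU PU hub [M psiM] a0 b1 psi_equiv.
set s := sup _ in psi_equiv *.
have s0 : 0 < s by apply: sup_support_gt0 => //; have [] := mom 1%N isT.
have b0 : 0 <= b := bounded_equiv_powR_ge0 R psi s a b M s0 a0 psiM psi_equiv.
have [C C0 psiC] := bounded_equiv_powR_le R psi s a b M a0 b0 psiM psi_equiv.
have k1 : 1 <= b + 1 by rewrite lerDr.
have lam0 : 0 < s^-1 by rewrite invr_gt0.
pose g0 := gamma_kernel (b + 1) s^-1 \_ `]0, +oo[.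
have ig0 : (@lebesgue_measure R).-integrable [set: R] (EFin \o g0).
  exact: integrable_gamma_kernel.
have g00 x : 0 <= g0 x.
  by rewrite /g0 patchE; case: ifPn => // _; exact: gamma_kernel_ge0.
pose J (g f : R -> R) := (\int[@lebesgue_measure R]_x (f x * g x)%:E)%E.
have I0E : (\int[@lebesgue_measure R]_(x in `]0%R, +oo[)
    (gamma_kernel (b + 1) s^-1 x)%:E = \int[@lebesgue_measure R]_x (g0 x)%:E)%E.
  rewrite integral_mkcond; apply: eq_integral => x _.
  by rewrite /g0 !patchE; case: ifPn.
set I0 := (\int[@lebesgue_measure R]_x (g0 x)%:E)%E in I0E.
have fI0 : I0 \is a fin_num by exact: integrable_fin_num.
have I00 : 0 < fine I0.
  rewrite fine_gt0// -ge0_fin_numE ?fI0 ?andbT//; last first.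
    by apply: integral_ge0 => x _; rewrite lee_fin.
  by rewrite -I0E integral_gamma_kernel_gt0.
move=> f cf bf.
have mf : measurable_fun [set: R] f by exact: continuous_measurable_fun.
have ifg0 : (@lebesgue_measure R).-integrable [set: R]
    (fun x => (f x * g0 x)%:E).
  apply: (@integrableMr _ (measurableTypeR R) R lebesgue_measure _ measurableT
    f (EFin \o g0) mf _ ig0).
  case: bf => N fN; exists N; split; first exact: num_real.
  by move=> y Ny x _ /=; rewrite (le_trans (fN x)) ?ltW.
(* The factor a is kept in both numerator and denominator, to match the separate limits of the two
   integrals. *)
have gammaE : (\int[@lebesgue_measure R]_x (f x * gamma_pdf (b + 1) s^-1 x)%:E =
    (a * fine (J g0 f) / (a * fine I0))%:E)%E.
  transitivity ((fine I0)^-1%:E * J g0 f)%E; last first.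
    have fJ : J g0 f \is a fin_num by exact: integrable_fin_num.
    rewrite -{1}(fineK fJ) -EFinM; congr EFin.
    by field; rewrite !gt_eqF.
  rewrite /J -integralZl//; apply: eq_integral => x _.
  rewrite /gamma_pdf /g0 patchE mem_setE in_itv/= andbT.
  by case: ifPn => _; rewrite ?mulr0 ?mule0// -EFinM I0E; congr EFin; ring.
pose k n := scaled_density R psi s b n.
have ik n : (@lebesgue_measure R).-integrable [set: R] (EFin \o k n).
  apply: (@le_integrable _ (measurableTypeR R) R lebesgue_measure _ measurableT
    _ (fun x => C%:E * (g0 x)%:E)%E).
  - by apply/measurable_EFinP; exact: measurable_scaled_density.
  - move=> x _ /=; rewrite lee_fin [leRHS]ger0_norm ?(mulr_ge0 (ltW C0))//.
    by rewrite ger0_norm ?scaled_density_ge0// scaled_density_le// ltW.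
  - exact: integrableZl.
(* The shift discards d = 0, where nothing is assumed about [U]. *)
rewrite gammaE -cvg_shiftS/=.
have -> : (fun n => \int[P]_w (f (n.+1%:R * (s - U n.+1 w)))%:E)%E =
    (fun n => (fine (J (k n) f) / fine (J (k n) (cst 1)))%:E).
  apply/funext => n; set c := (fine (moment psi n.+1))^-1.
  rewrite (integral_normalized_density R dT T P _
    (n.+1%:R^-1 * (c * s ^+ n.+1 / n.+1%:R `^ b)) (k n))//.
  - by congr (_ / fine _)%:E; apply: eq_integral => x _; rewrite mul1r.
  - apply: measurable_funM => //; apply: measurable_funB => //; exact: mU.
  - move=> A mA; rewrite -scaled_density_law//; last first.
      rewrite invr_ge0 fine_ge0// integral_ge0// => u /=.
      rewrite in_itv/= andbT => u0.
      by rewrite lee_fin mulr_ge0 ?psi0// exprn_ge0.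
    rewrite -PU// -[X in measurable X]setTI.
    have : measurable_fun [set: R] (fun u : R => n.+1%:R * (s - u)).
      by apply: measurable_funM => //; exact: measurable_funB.
    exact.
have cvgJ (h : R -> R) : measurable_fun [set: R] h ->
    (exists M : R, forall x, `|h x| <= M) ->
    (@lebesgue_measure R).-integrable [set: R] (fun x => (h x * g0 x)%:E) ->
    fine (J (k n) h) @[n --> \oo] --> a * fine (J g0 h).
  move=> mh bh ih; apply: fine_cvg.
  have -> : (a * fine (J g0 h))%:E = (\int[@lebesgue_measure R]_x
      (h x * (a * g0 x))%:E)%E.
    have fJ : J g0 h \is a fin_num by exact: integrable_fin_num.
    rewrite EFinM fineK// -integralZl//.
    by apply: eq_integral => x _; rewrite -EFinM mulrCA.
  by apply: (cvg_integral_scaled_density _ _ _ _ _ _ C) => //; exact: ltW.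
have J1 : J g0 (cst 1) = I0.
  by apply: eq_integral => x _; rewrite mul1r.
apply: cvg_EFin; first exact: nearW.
apply: cvgM; first exact: cvgJ.
apply: cvgV; first by rewrite gt_eqF// mulr_gt0.
rewrite -J1; apply: cvgJ => //.
- by exists 1 => x; rewrite /cst normr1.
- by apply: eq_integrable ig0 => // x _ /=; rewrite mul1r.
Qed.
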